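(* Let $\{U(S)\}_{\emptyset\neq S\subseteq N}$ be the NTU LP game given by $A\in\mathbb{Q}^{K\times J}$, $\{b^i\}_{i\in N}\subset\mathbb{Q}^K$ and $\{v^i\}_{i\in N}\subset\mathbb{Q}^J$, where $X(\{i\})$ is non-empty and bounded for every $i\in N$, and suppose that its core satisfies $C(N)\neq\emptyset$. Then $C(N)$ is MIP-representable.
   Context: Let $N$ (players), $K$ (resources), $J$ (public goods) be finite non-empty sets. The data are a production matrix $A\in\mathbb{Q}^{K\times J}$, resource endowments $b^i\in\mathbb{Q}^K$ and valuation vectors $v^i\in\mathbb{Q}^J$ for $i\in N$. For a coalition $\emptyset\neq S\subseteq N$ put $b(S)=\sum_{i\in S}b^i$ and $$X(S)=\{x\in\mathbb{R}^J_{\geq 0}: Ax\leq b(S)\},$$ $$Z(S)=\{(x,u)\in\mathbb{R}^J\times\mathbb{R}^N: x\in X(S),\ u_i\leq (v^i)^Tx\ \ \forall i\in S\},$$ $$U(S)=\mathrm{proj}_u(Z(S))\subseteq\mathbb{R}^N .$$ (Coordinates $u_i$, $i\notin S$, are unconstrained in $U(S)$.) The collection $\{U(S)\}_{\emptyset\neq S\subseteq N}$ is the non-transferable utility linear production (NTU LP) game given by $A,\{b^i\},\{v^i\}$. Its core is $$C(N)=U(N)\setminus\bigcup_{\emptyset\neq S\subseteq N}\mathrm{int}(U(S)),$$ with interior taken in $\mathbb{R}^N$. A set $C\subseteq\mathbb{R}^n$ is MIP-representable (mixed-integer linear programming representable) if there are integers $p,q\geq 0$ and a rational polyhedron $Q\subseteq\mathbb{R}^n\times\mathbb{R}^p\times\mathbb{R}^q$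 such that $C=\{u\in\mathbb{R}^n:\exists\, w\in\mathbb{R}^p,\ z\in\mathbb{Z}^q \text{ with } (u,w,z)\in Q\}$. *)

(* Defs.v *)
From HB Require Import structures.
From mathcomp Require Import all_boot all_order all_algebra.
From mathcomp Require Import all_classical all_reals all_analysis.
Set Implicit Arguments. Unset Strict Implicit. Unset Printing Implicit Defensive.
Import Order.TTheory GRing.Theory Num.Theory.
Import numFieldNormedType.Exports.
Local Open Scope classical_set_scope.
Local Open Scope ring_scope.

(* Finite non-empty index sets are ordinals ['I_n.+1]; in the game below,
   [n.+1] players, [k.+1] resources, [j.+1] public goods. *)

Section NTULPGame.
Context {R : realType} {n k j : nat}.
Variables (A : 'M[rat]_(k.+1, j.+1)) (b : 'I_n.+1 -> 'cV[rat]_k.+1)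
  (v : 'I_n.+1 -> 'cV[rat]_j.+1).

Definition endowment (S : {set 'I_n.+1}) : 'cV[rat]_k.+1 := \sum_(i in S) b i.

Definition feasible (S : {set 'I_n.+1}) : set 'cV[R]_j.+1 :=
  [set x : 'cV[R]_j.+1 | (forall g, 0 <= x g 0) /\
           (forall r, (map_mx ratr A *m x) r 0 <= ratr (endowment S r 0))].

Definition allocations (S : {set 'I_n.+1}) : set ('cV[R]_j.+1 * 'cV[R]_n.+1) :=
  [set xu : 'cV[R]_j.+1 * 'cV[R]_n.+1 | feasible S xu.1 /\
    (forall i, i \in S -> xu.2 i 0 <= ((map_mx ratr (v i))^T *m xu.1) 0 0)].

Definition utilities (S : {set 'I_n.+1}) : set 'cV[R]_n.+1 :=
  snd @` allocations S.

(* [finset.setT] is the grand coalition; the union also runs over it. *)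
Definition core : set 'cV[R]_n.+1 :=
  utilities finset.setT `\`
  \bigcup_(S in [set S : {set 'I_n.+1} | S != finset.set0])
     interior (utilities S).

End NTULPGame.

Arguments feasible R {n k j} A b S.
Arguments allocations R {n k j} A b v S.
Arguments utilities R {n k j} A b v S.
Arguments core R {n k j} A b v.

Definition rational_polyhedron {R : realType} {d : nat} (Q : set 'cV[R]_d) :=
  exists (m : nat) (M : 'M[rat]_(m, d)) (c : 'cV[rat]_m),
    Q = [set x : 'cV[R]_d | forall i, (map_mx ratr M *m x) i 0 <= ratr (c i 0)].

Definition MIP_representable {R : realType} {n : nat} (C : set 'cV[R]_n) :=
  exists (p q : nat) (Q : set 'cV[R]_(n + p + q)),
    rational_polyhedron Q /\
    C = [set u : 'cV[R]_n | exists (w : 'cV[R]_p) (z : 'cV[int]_q),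
                   Q (col_mx (col_mx u w) (map_mx intr z))].

(* Main.v *)
(* Each U(S) is the projection of a rational polyhedron, hence a rational
   polyhedron by Fourier-Motzkin elimination, so the complement of its interior
   is a finite union of closed rational half-spaces. The core is therefore a
   finite union of rational polyhedra. It is bounded: the inequalities u \notin
   int U({i}) bound it below, and X(N) is bounded because X({i}) is. A bounded
   finite union of rational polyhedra is MIP-representable by big-M constraints
   with one integer variable per polyhedron. *)
Require Import Defs.
From mathcomp Require Import all_boot all_order all_algebra.
From mathcomp Require Import all_classical all_reals all_analysis.
From mathcomp Require Import zify lra.
Import Order.TTheory GRing.Theory Num.Theory.
Import numFieldNormedType.Exports.
Local Open Scope classical_set_scope.
Local Open Scope ring_scope.

Set Implicit Arguments.
Unset Strict Implicit.

(** * Rational linear constraints and Fourier-Motzkin elimination *)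

Section Constraints.
Context {R : realFieldType} {d : nat}.
Implicit Types (x y : 'cV[R]_d) (t : 'I_d).
Local Notation constraint := ('rV[rat]_d * rat)%type.
Implicit Types (g h : constraint) (L : seq constraint).

Definition lform (a : 'rV[rat]_d) x : R := (map_mx ratr a *m x) 0 0.

Definition sat x g := lform g.1 x <= ratr g.2.

Lemma lformE a x : lform a x = \sum_t ratr (a 0 t) * x t 0.
Proof. by rewrite /lform mxE; apply: eq_bigr => t _; rewrite mxE. Qed.

Lemma lform0 x : lform 0 x = 0.
Proof. by rewrite /lform map_mx0 mul0mx mxE. Qed.

Lemma lformDl a a' x : lform (a + a') x = lform a x + lform a' x.
Proof. by rewrite /lform map_mxD mulmxDl mxE. Qed.

Lemma lformZl (r : rat) a x : lform (r *: a) x = ratr r * lform a x.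
Proof. by rewrite /lform map_mxZ -scalemxAl mxE. Qed.

Lemma lformN a x : lform (- a) x = - lform a x.
Proof. by rewrite -scaleN1r lformZl rmorphN1 mulN1r. Qed.

Lemma lformDr a x y : lform a (x + y) = lform a x + lform a y.
Proof. by rewrite /lform mulmxDr mxE. Qed.

Lemma lformZr a (s : R) x : lform a (s *: x) = s * lform a x.
Proof. by rewrite /lform -scalemxAr mxE. Qed.

Lemma lform_delta a t : lform a (delta_mx t 0) = ratr (a 0 t).
Proof.
rewrite lformE (bigD1 t) //= mxE !eqxx mulr1 big1 ?addr0 // => i /negPf it.
by rewrite mxE it mulr0.
Qed.

Lemma lform_delta_row t x : lform (delta_mx 0 t) x = x t 0.
Proof. by rewrite /lform map_delta_mx -rowE mxE. Qed.

Lemma lform_trmx a : lform a (map_mx ratr a^T) = \sum_t ratr (a 0 t) ^+ 2.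
Proof. by rewrite lformE; apply: eq_bigr => t _; rewrite !mxE expr2. Qed.

(** When [g.1 0 t > 0 > h.1 0 t], both multipliers are positive and the coefficient at [t]
    cancels. *)
Definition fm_comb t g h : constraint :=
  (- h.1 0 t *: g.1 + g.1 0 t *: h.1, - h.1 0 t * g.2 + g.1 0 t * h.2).

(** Coordinate [t] stays, with coefficient 0, so that eliminations iterate in a fixed dimension. *)
Definition fm_elim t L : seq constraint :=
  [seq g : constraint <- L | g.1 0 t == 0] ++
  [seq fm_comb t g h | g <- [seq g : constraint <- L | 0 < g.1 0 t],
                       h <- [seq h : constraint <- L | h.1 0 t < 0]].

Lemma finite_separation (lo up : seq R) :
  (forall l u, l \in lo -> u \in up -> l <= u) ->
  exists s, (forall l, l \in lo -> l <= s) /\ (forall u, u \in up -> s <= u).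
Proof.
elim: lo => [|l lo IH] H.
  elim: up {H} => [|u up [s [_ Hs]]]; first by exists 0.
  exists (Num.min u s); split=> // u'; rewrite in_cons => /predU1P[->|/Hs H].
    by rewrite ge_min lexx.
  by rewrite ge_min H orbT.
have [l' u lo' uu|s [Hl Hu]] := IH.
  by apply: H => //; rewrite in_cons lo' orbT.
exists (Num.max l s); split=> [l'|u uu].
  by rewrite in_cons => /predU1P[->|/Hl H']; rewrite le_max ?lexx ?H' ?orbT.
by rewrite ge_max Hu // H // mem_head.
Qed.

(** On the line [x + s e_t], a constraint with nonzero coefficient at [t] bounds [s] from above or
    from below; the combined constraints say that each lower bound is at most each upper bound. *)
Lemma fm_elimP t L x :
  all (sat x) (fm_elim t L) <-> exists s, all (sat (x + s *: delta_mx t 0)) L.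
Proof.
have satE s g : sat (x + s *: delta_mx t 0) g =
    (lform g.1 x + s * ratr (g.1 0 t) <= ratr g.2).
  by rewrite /sat lformDr lformZr lform_delta.
have ratr_gt0 (q : rat) : ((0 : R) < ratr q) = (0 < q) by rewrite ltr0q.
have ratr_lt0 (q : rat) : ((ratr q : R) < 0) = (q < 0) by rewrite ltrq0.
have combE g h : sat x (fm_comb t g h) =
    (- ratr (h.1 0 t) * lform g.1 x + ratr (g.1 0 t) * lform h.1 x
     <= - ratr (h.1 0 t) * ratr g.2 + ratr (g.1 0 t) * ratr h.2).
  by rewrite /sat /= lformDl !lformZl rmorphD !rmorphM /= rmorphN.
split=> [|[s /allP Hs]]; last first.
  apply/allP => e; rewrite mem_cat => /orP[|].
    rewrite mem_filter => /andP[/eqP e0 /Hs].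
    by rewrite satE e0 rmorph0 mulr0 addr0.
  case/allpairsP => -[g h] /= [].
  rewrite !mem_filter => /andP[g0 /Hs Hg] /andP[h0 /Hs Hh] ->.
  move: Hg Hh; rewrite combE !satE.
  move: g0 h0; rewrite -ratr_gt0 -ratr_lt0.
  nra.
rewrite /fm_elim all_cat => /andP[/allP H0 /allP Hc].
(* [bnd g] is the value of [s] at which [g] becomes tight. *)
pose bnd g := (ratr g.2 - lform g.1 x) / ratr (g.1 0 t).
have [|s [Hl Hu]] := @finite_separation
  [seq bnd h | h <- [seq h : constraint <- L | h.1 0 t < 0]]
  [seq bnd g | g <- [seq g : constraint <- L | 0 < g.1 0 t]].
  move=> _ _ /mapP[h hL ->] /mapP[g gL ->].
  have := Hc _ (allpairs_f (fm_comb t) gL hL); rewrite combE => Hgh.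
  move: gL hL; rewrite !mem_filter -ratr_gt0 -ratr_lt0 => /andP[g0 _] /andP[h0 _].
  rewrite /bnd ler_ndivrMr // [leLHS]mulrAC ler_pdivrMr //.
  lra.
exists s; apply/allP => g gL; rewrite satE.
case: (ltrgtP (g.1 0 t) 0) => g0.
- have : bnd g <= s by apply/Hl/map_f; rewrite mem_filter g0.
  by rewrite /bnd ler_ndivrMr ?ratr_lt0 // lerBrDl.
- have : s <= bnd g by apply/Hu/map_f; rewrite mem_filter g0.
  by rewrite /bnd ler_pdivlMr ?ratr_gt0 // lerBrDl.
- have := H0 g; rewrite mem_filter g0 eqxx gL => /(_ isT).
  by rewrite rmorph0 mulr0 addr0.
Qed.

Lemma fm_elim_seq (l : seq 'I_d) L : exists L', forall x,
  all (sat x) L' <->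
  exists y, (forall t, t \notin l -> y t 0 = x t 0) /\ all (sat y) L.
Proof.
elim: l => [|t l [L' IH]].
  exists L => x; split=> [xL|[y [yx yL]]]; first by exists x.
  suff -> : x = y by [].
  by apply/matrixP => i k; rewrite ord1 yx.
exists (fm_elim t L') => x; rewrite fm_elimP; split=> [[s /IH[y [yx yL]]]|].
  exists y; split=> // i; rewrite in_cons negb_or => /andP[it il].
  by rewrite yx // !mxE (negPf it) /= mulr0 addr0.
(* The shift along [t] gives coordinate [t] its value in [y]; the induction hypothesis takes care of
   the coordinates in [l]. *)
case=> y [yx yL]; exists (y t 0 - x t 0); apply/IH; exists y; split=> // i il.
rewrite !mxE eqxx andbT; case: eqVneq => [->|it].
  by rewrite mulr1 addrC subrK.
by rewrite mulr0 addr0 yx // in_cons negb_or it.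
Qed.

End Constraints.

Lemma lform_row_mx (R : realFieldType) m d (a : 'rV[rat]_m) (a' : 'rV[rat]_d)
    (x : 'cV[R]_m) (y : 'cV[R]_d) :
  lform (row_mx a a') (col_mx x y) = lform a x + lform a' y.
Proof. by rewrite /lform map_row_mx mul_row_col mxE. Qed.

(** The eliminated system is insensitive to the [x] block, so that block is set to 0 and its columns
    are dropped. *)
Lemma fm_project (R : realFieldType) m d (L : seq ('rV[rat]_(m + d) * rat)) :
  exists L', forall u : 'cV[R]_d,
    all (sat u) L' <-> exists x : 'cV[R]_m, all (sat (col_mx x u)) L.
Proof.
have [L' HL'] := @fm_elim_seq R _ [seq lshift d i | i <- enum 'I_m] L.
exists [seq (rsubmx g.1, g.2) | g <- L'] => u.
have -> : all (sat u) [seq (rsubmx g.1, g.2) | g <- L'] =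
          all (sat (col_mx (0 : 'cV[R]_m) u)) L'.
  rewrite all_map; apply: eq_all => g /=; rewrite /sat /= -[in RHS](hsubmxK g.1).
  by rewrite lform_row_mx [lform _ 0]/lform mulmx0 mxE add0r.
rewrite HL'; split=> [[y [yu yL]]|[x xL]].
  exists (usubmx y); suff -> : u = dsubmx y by rewrite vsubmxK.
  apply/matrixP => i k; rewrite ord1 mxE yu ?col_mxEd //.
  by apply/mapP => -[i' _ /eqP]; rewrite eq_rlshift.
exists (col_mx x u); split=> // t.
case: (split_ordP t) => i ->; last by rewrite !col_mxEd.
by rewrite mem_map ?mem_enum //; apply: lshift_inj.
Qed.

(** * Finite unions of rational polyhedra, and interiors of polyhedra *)

Section PolyhedralUnions.
Context {R : realType} {d : nat}.
Local Notation constraint := ('rV[rat]_d * rat)%type.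
Implicit Types (C P : set 'cV[R]_d) (L : seq constraint) (u : 'cV[R]_d).

(** Disjunctive normal form: [[::]] encodes the empty set and [[:: [::]]] the whole space. *)
Definition polyhedral_union C :=
  exists D : seq (seq constraint), forall u,
    C u <-> has (fun L => all (sat u) L) D.

Lemma polyhedral_unionT : polyhedral_union setT.
Proof. by exists [:: [::]]. Qed.

Lemma polyhedral_unionI C C' :
  polyhedral_union C -> polyhedral_union C' -> polyhedral_union (C `&` C').
Proof.
move=> [D HD] [D' HD'].
exists [seq L ++ L' | L <- D, L' <- D'] => u; split.
  move=> [/HD/hasP[L LD uL] /HD'/hasP[L' LD' uL']].
  apply/hasP; exists (L ++ L'); first exact: allpairs_f.
  by rewrite all_cat uL uL'.
case/hasP => _ /allpairsP[[L L'] /= [LD LD' ->]]; rewrite all_cat.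
by case/andP => uL uL'; split; [apply/HD|apply/HD']; apply/hasP;
  [exists L|exists L'].
Qed.

Lemma polyhedral_union_bigcap (I : eqType) (s : seq I) (F : I -> set 'cV[R]_d) :
  (forall i, i \in s -> polyhedral_union (F i)) ->
  polyhedral_union [set u | forall i, i \in s -> F i u].
Proof.
elim: s => [_|i s IH Fs].
  suff -> : [set u | forall i, i \in [::] -> F i u] = setT.
    exact: polyhedral_unionT.
  by apply/seteqP; split.
suff -> : [set u | forall i', i' \in i :: s -> F i' u] =
          F i `&` [set u | forall i, i \in s -> F i u].
  apply: polyhedral_unionI; first exact/Fs/mem_head.
  by apply: IH => i' i's; apply: Fs; rewrite in_cons i's orbT.
apply/seteqP; split=> u /=.
  move=> Fu; split=> [|i' i's]; first exact/Fu/mem_head.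
  by apply: Fu; rewrite in_cons i's orbT.
by move=> [Fi Fu] i'; rewrite in_cons => /predU1P[->|/Fu].
Qed.

Lemma continuous_lform (a : 'rV[rat]_d) :
  continuous (lform a : 'cV[R]_d -> R).
Proof.
move=> u.
rewrite (_ : lform a = fun x : 'cV[R]_d => \sum_t ratr (a 0 t) * x t 0); last first.
  by apply/funext => x; rewrite lformE.
apply: (@cvg_big _ _ _ _ _ add_continuous _ (nbhs u)) => t _.
by apply: cvgM; [exact: cvg_cst|exact: coord_continuous].
Qed.

(** Moving an interior point along the normal of [g] raises [lform g.1], which forces strictness;
    conversely, strict inequalities persist nearby by continuity. A constraint with [g.1 = 0] is
    constant in [u] and holds because [P] is non-empty. *)
Lemma interior_polyhedron P L : (forall u, P u <-> all (sat u) L) ->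
  P !=set0 -> forall u, interior P u <->
    forall g, g \in L -> g.1 != 0 -> lform g.1 u < ratr g.2.
Proof.
move=> PL [u0 /PL/allP u0L] u; split=> [Pu g gL g0|uL].
  pose w : 'cV[R]_d := map_mx ratr g.1^T.
  have w0 : 0 < lform g.1 w.
    rewrite lform_trmx lt0r sumr_ge0 ?andbT => [|t _]; last exact: sqr_ge0.
    apply: contra g0 => /eqP/psumr_eq0P s0; apply/eqP/rowP => t; rewrite mxE.
    have /eqP := s0 (fun t _ => sqr_ge0 _) t isT.
    by rewrite sqrf_eq0 fmorph_eq0 => /eqP.
  (* An interior point can be moved by some [s > 0] along [w] without leaving [P]. *)
  have cw : u + s *: w @[s --> (0 : R)^'+] --> u.
    apply: cvg_at_right_filter; rewrite -[X in _ --> X](addr0 u) -(scale0r w).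
    by apply: cvgD; [exact: cvg_cst|apply: cvgZr_tmp; exact: cvg_id].
  have near_s : \forall s \near (0 : R)^'+, 0 < s /\ P (u + s *: w).
    by apply: filterI; [exact: nbhs_right_gt|exact: cw].
  have [s [s0 /PL/allP/(_ g gL)]] := filter_ex near_s.
  rewrite /sat lformDr lformZr; apply: lt_le_trans.
  by rewrite ltrDl mulr_gt0.
suff : \forall w \near u, all (sat w) L.
  by apply: filterS => w /PL.
have {PL}: forall g, g \in L -> \forall w \near u, sat w g.
  move=> g gL; have [g0|g0] := eqVneq g.1 0.
    apply: filterE => w; have := u0L g gL.
    by rewrite /sat g0 !lform0.
  have := continuous_lform (x := u) (a := g.1).
  move=> /cvgr_lt/(_ _ (uL g gL g0)).
  by apply: filterS => w /ltW.
elim: L {u0L uL} => [|g L IH] nL; first by apply: filterE.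
have := nL g (mem_head _ _).
have : \forall w \near u, all (sat w) L.
  by apply: IH => g' g'L; apply: nL; rewrite in_cons g'L orbT.
by apply: filterS2 => w /= -> ->.
Qed.

(** Negating the strict inequalities leaves one closed half-space for each constraint with nonzero
    normal; for empty [P] the complement is the whole space. *)
Lemma polyhedral_union_setC_interior P L :
  (forall u, P u <-> all (sat u) L) -> polyhedral_union (~` interior P).
Proof.
move=> PL; have [P0|/set0P/negP/negPn/eqP P0] := pselect (P !=set0); last first.
  by rewrite P0 interior0 setC0; exact: polyhedral_unionT.
exists [seq [:: (- g.1, - g.2)] | g : constraint <- L & g.1 != 0] => u.
split=> [nPu|/hasP[_ /mapP[g + ->]]].
  rewrite has_map; apply: contrapT => /negP/hasPn nh; apply: nPu.
  apply/(interior_polyhedron PL P0) => g gL g0.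
  have := nh g; rewrite mem_filter g0 gL /= andbT /sat /= => /(_ isT).
  by rewrite lformN rmorphN lerN2 -ltNge.
rewrite mem_filter /= andbT /sat /= => /andP[g0 gL].
rewrite lformN rmorphN lerN2 => gu.
move=> /(interior_polyhedron PL P0)/(_ g gL g0).
by rewrite ltNge gu.
Qed.

Lemma rational_polyhedron_seq L :
  rational_polyhedron [set u : 'cV[R]_d | all (sat u) L].
Proof.
pose g i := nth (0, 0) L i.
exists (size L), (\matrix_(i, t) (g i).1 0 t), (\col_i (g i).2).
have E (u : 'cV[R]_d) (i : ordinal (size L)) :
    (map_mx ratr (\matrix_(i, t) (g i).1 0 t) *m u) i 0 =
    lform (g i).1 u.
  by rewrite lformE mxE; apply: eq_bigr => t _; rewrite !mxE.
apply/seteqP; split=> u /=.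
  by move=> /allP uL i; rewrite E mxE; apply/uL/mem_nth.
move=> uL; apply/(all_nthP (0, 0)) => i iL.
by have := uL (Ordinal iL); rewrite E mxE.
Qed.

End PolyhedralUnions.

(** * Big-M formulation of a bounded union of polyhedra *)

Lemma MIP_representable_polyhedral_union (R : realType) (n : nat)
    (C : set 'cV[R]_n) :
  polyhedral_union C -> (exists B : R, forall u i, C u -> `|u i 0| <= B) ->
  MIP_representable C.
Proof.
case=> D DP [B CB].
(* By the bound [B], one [M] relaxes every constraint of every polyhedron on all of [C]; it is a
   natural number so that the system stays rational. *)
have [M CM] : exists M : nat, forall g, g \in flatten D ->
    forall u, C u -> lform g.1 u <= ratr g.2 + M%:R.
  elim: (flatten D) => [|g L [M CM]]; first by exists 0%N.
  pose X : R := \sum_t `|ratr (g.1 0 t)| * B - ratr g.2.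
  exists (maxn M (Num.bound `|X|)) => h.
  rewrite in_cons => /predU1P[->|hL] u Cu; last first.
    by apply: le_trans (CM h hL u Cu) _; rewrite lerD2l ler_nat leq_maxl.
  rewrite -lerBlDl.
  apply: (@le_trans _ _ (Num.bound `|X|)%:R); last by rewrite ler_nat leq_maxr.
  apply: le_trans (ltW (archi_boundP (normr_ge0 X))).
  apply: le_trans (ler_norm X).
  rewrite lerD2r lformE; apply: ler_sum => t _.
  apply: le_trans (ler_norm _) _.
  by rewrite normrM ler_wpM2l // CB.
(* The constraints are [\sum_s z s >= 1] and, for each [g] in the [s]-th
   polyhedron, [g.1 u + M * z s <= g.2 + M]. There is no need to force
   [z s] into [{0, 1}]: some [z s >= 1], and this yields [g.1 u <= g.2]. *)
pose L : seq ('rV[rat]_(n + 0 + size D) * rat) :=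
  (row_mx 0 (const_mx (-1)), -1) ::
  flatten [seq [seq (row_mx (row_mx g.1 0) (M%:R *: delta_mx 0 s), g.2 + M%:R)
               | g <- nth [::] D s] | s <- enum 'I_(size D)].
exists 0%N, (size D), [set x | all (sat x) L]; split.
  exact: rational_polyhedron_seq.
have L1 (u : 'cV[R]_n) w (z : 'cV[int]_(size D)) :
    sat (col_mx (col_mx u w) (map_mx intr z))
      ((row_mx 0 (const_mx (-1)), -1) : 'rV[rat]_(n + 0 + size D) * rat) =
    (1 <= \sum_s z s 0).
  rewrite /sat /= lform_row_mx lform0 add0r lformE rmorphN1.
  rewrite (eq_bigr (fun s => - (z s 0)%:~R)) => [|s _]; last first.
    by rewrite !mxE rmorphN1 mulN1r.
  by rewrite sumrN lerN2 -rmorph_sum /= ler1z.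
have L2 (u : 'cV[R]_n) (w : 'cV[R]_0) (z : 'cV[int]_(size D)) s
    (g : 'rV[rat]_n * rat) :
    sat (col_mx (col_mx u w) (map_mx intr z))
      (row_mx (row_mx g.1 0) (M%:R *: delta_mx 0 s), g.2 + M%:R) =
    (lform g.1 u + M%:R * (z s 0)%:~R <= ratr g.2 + M%:R).
  rewrite /sat /= !lform_row_mx lform0 addr0 lformZl rmorphD /= !ratr_nat.
  congr (_ + _ * _ <= _).
  rewrite lformE (bigD1 s) //= !mxE !eqxx rmorph1 mul1r big1 ?addr0 //.
  by move=> i /negPf si; rewrite !mxE si andbF rmorph0 mul0r.
apply/seteqP; split=> u /=.
  move=> Cu; have /(DP u)/(has_nthP [::])[s0 s0D /allP us] := Cu.
  pose s := Ordinal s0D.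
  (* [z] is the indicator of one polyhedron containing [u]. *)
  exists 0, (delta_mx s 0); rewrite L1; apply/andP; split.
    by rewrite (bigD1 s) //= mxE !eqxx lerDl sumr_ge0 // => i _; rewrite mxE.
  apply/allP => _ /flattenP[_ /mapP[i _ ->] /mapP[g gi ->]]; rewrite L2 mxE.
  have [is_|nis] := eqVneq i s.
    by rewrite mulr1 lerD2r; apply: us; rewrite is_ in gi.
  rewrite mulr0 addr0; apply: CM Cu.
  by apply/flattenP; exists (nth [::] D i) => //; exact: mem_nth.
case=> w [z]; rewrite L1 => /andP[z1 /allP zL].
(* By integrality, if no [z s] were at least 1, all would be at most 0, and so would their sum. *)
have [s zs] : exists s, 1 <= z s 0.
  apply: contrapT => /forallNP zn; move: z1; apply/negP; rewrite -ltNge.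
  apply: (@le_lt_trans _ _ 0) => //; apply: sumr_le0 => s _.
  by have /negP := zn s; lia.
apply/DP/(has_nthP [::]); exists s => //; apply/allP => g gs.
have : sat (col_mx (col_mx u w) (map_mx intr z))
   (row_mx (row_mx g.1 0) (M%:R *: delta_mx 0 s), g.2 + M%:R).
  by apply/zL/flatten_mapP; exists s; [rewrite mem_enum|exact: map_f].
rewrite L2 /sat; apply: contraTT; rewrite -!ltNge => gu.
by rewrite ltr_leD // ler_peMr // (ler_int _ 1).
Qed.

(** * Boundedness of production sets under a change of resources *)

Section ProductionPolyhedron.
Context {R : realType} {k j : nat}.
Variable A : 'M[rat]_(k, j).

(** The right-hand side is an arbitrary real vector, so that it can serve as a block of variables in
    the elimination. *)
Definition production (beta : 'cV[R]_k) : set 'cV[R]_j :=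
  [set x : 'cV[R]_j | (forall g, 0 <= x g 0) /\
           (forall r, (map_mx ratr A *m x) r 0 <= beta r 0)].

Lemma lform_row r (x : 'cV[R]_j) :
  lform (row r A) x = (map_mx ratr A *m x) r 0.
Proof. by rewrite lformE mxE; apply: eq_bigr => t _; rewrite !mxE. Qed.

(* Fourier-Motzkin elimination of the other goods from
   [{(x, beta) | x >= 0, A x <= beta}] leaves constraints on [(x g, beta)]
   whose coefficients do not depend on [beta]; for any [beta] with a feasible
   [x], [x g] is bounded iff some constraint has a positive coefficient at
   [x g]. *)
Lemma production_bounded_rhs (g : 'I_j) (beta beta' : 'cV[R]_k) (B : R) :
  production beta !=set0 -> (forall x, production beta x -> x g 0 <= B) ->
  exists B', forall x, production beta' x -> x g 0 <= B'.
Proof.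
move=> [x0 x0P] xB.
pose L : seq ('rV[rat]_(j + k) * rat) :=
  [seq (row_mx (- delta_mx 0 i) 0, 0) | i <- enum 'I_j] ++
  [seq (row_mx (row r A) (- delta_mx 0 r), 0) | r <- enum 'I_k].
have LP b x : all (sat (col_mx x b)) L <-> production b x.
  split=> [/allP xL|[x_ge0 Ax]].
    split=> [i|r].
      have := xL (row_mx (- delta_mx 0 i) 0, 0); rewrite /sat /= lform_row_mx.
      rewrite lform0 addr0 lformN lform_delta_row rmorph0 oppr_le0; apply.
      by rewrite mem_cat map_f ?mem_enum.
    have := xL (row_mx (row r A) (- delta_mx 0 r), 0); rewrite /sat /=.
    rewrite lform_row_mx lformN lform_delta_row lform_row rmorph0 subr_le0.
    by apply; rewrite mem_cat orbC map_f ?mem_enum.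
  rewrite all_cat; apply/andP; split; apply/allP => _ /mapP[i _ ->].
    by rewrite /sat /= lform_row_mx lform0 addr0 lformN lform_delta_row rmorph0
               oppr_le0.
  by rewrite /sat /= lform_row_mx lformN lform_delta_row lform_row rmorph0
             subr_le0.
have [L' HL'] :=
  @fm_elim_seq R _ [seq lshift k i | i <- enum 'I_j & i != g] L.
(* The entries of the eliminated goods are set to 0; their values do not affect the truth of the
   system [L']. *)
pose pt s (b : 'cV[R]_k) : 'cV[R]_(j + k) :=
  col_mx 0 b + s *: delta_mx (lshift k g) 0.
have ptE b s : all (sat (pt s b)) L' <-> exists x, production b x /\ x g 0 = s.
  have ptg : pt s b (lshift k g) 0 = s.
    by rewrite mxE col_mxEu !mxE !eqxx mulr1 add0r.
  have ptd r : pt s b (rshift j r) 0 = b r 0.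
    by rewrite mxE col_mxEd !mxE eq_rlshift mulr0 addr0.
  rewrite HL'; split=> [[y [yE yL]]|[x [xP xg]]].
    exists (usubmx y); split; last first.
      rewrite mxE yE // mem_map; last exact: lshift_inj.
      by rewrite mem_filter eqxx.
    apply/LP; suff -> : b = dsubmx y by rewrite vsubmxK.
    apply/matrixP => r c; rewrite ord1 mxE yE //.
    by apply/mapP => -[i _ /eqP]; rewrite eq_rlshift.
  exists (col_mx x b); split; last exact/LP.
  move=> t; case: (split_ordP t) => i ->; last by rewrite col_mxEd ptd.
  rewrite mem_map; last exact: lshift_inj.
  rewrite mem_filter mem_enum andbT.
  by move/negPn/eqP => ->; rewrite col_mxEu ptg.
have satE s b h : sat (pt s b) h =
    (lform h.1 (col_mx 0 b) + s * ratr (h.1 0 (lshift k g)) <= ratr h.2).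
  by rewrite /sat lformDr lformZr lform_delta.
(* A positive coefficient at [x g] bounds [x g] for every right-hand side, in particular for
   [beta']. *)
have [/hasP[h hL h0]|/hasPn L'0] :=
    boolP (has (fun h : 'rV[rat]_(j + k) * rat => 0 < h.1 0 (lshift k g)) L').
  exists ((ratr h.2 - lform h.1 (col_mx 0 beta')) / ratr (h.1 0 (lshift k g))).
  move=> x xP.
  have /allP/(_ h hL) : all (sat (pt (x g 0) beta')) L' by apply/ptE; exists x.
  by rewrite satE => ?; rewrite ler_pdivlMr ?ltr0q // lerBrDl.
(* All coefficients at [x g] are now at most 0, so raising it from [x0 g 0] to a value above [B]
   keeps [L'] satisfied, a contradiction. *)
pose s := Num.max B (x0 g 0) + 1.
have : all (sat (pt s beta)) L'.
  have /allP x0L : all (sat (pt (x0 g 0) beta)) L' by apply/ptE; exists x0.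
  apply/allP => h hL; move: (x0L h hL); rewrite !satE; apply: le_trans.
  rewrite lerD2l ler_wnM2r //; first by rewrite lerq0 leNgt L'0.
  by rewrite ler_wpDr ?ler01 ?le_max ?lexx ?orbT.
case/ptE => x [/xB + xs]; rewrite xs leNgt => /negP[].
by rewrite ltr_pwDr // le_max lexx.
Qed.

End ProductionPolyhedron.

(** * The game: polyhedral structure and boundedness of its core *)

Section Game.
Context {R : realType} {n k j : nat}.
Variables (A : 'M[rat]_(k.+1, j.+1)) (b : 'I_n.+1 -> 'cV[rat]_k.+1)
  (v : 'I_n.+1 -> 'cV[rat]_j.+1).

Lemma feasibleE S : feasible R A b S = production A (map_mx ratr (endowment b S)).
Proof.
by apply/seteqP; split=> x [x_ge0 Ax]; split=> // r;
  move: (Ax r); rewrite [map_mx _ (endowment b S) r 0]mxE.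
Qed.

Lemma valuationE i (x : 'cV[R]_j.+1) :
  ((map_mx ratr (v i))^T *m x) 0 0 = lform (v i)^T x.
Proof. by rewrite /lform map_trmx. Qed.

(** The three blocks of [L] describe [allocations] with the goods placed first, so eliminating the
    goods projects onto [u]. *)
Lemma utilities_polyhedron S :
  exists L, forall u, utilities R A b v S u <-> all (sat u) L.
Proof.
pose L : seq ('rV[rat]_(j.+1 + n.+1) * rat) :=
  [seq (row_mx (- delta_mx 0 g) 0, 0) | g <- enum 'I_j.+1] ++
  [seq (row_mx (row r A) 0, endowment b S r 0) | r <- enum 'I_k.+1] ++
  [seq (row_mx (- (v i)^T) (delta_mx 0 i), 0) | i <- enum S].
have [L' HL'] := @fm_project R _ _ L.
exists L' => u; rewrite HL'.
have LP (x : 'cV[R]_j.+1) :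
    allocations R A b v S (x, u) <-> all (sat (col_mx x u)) L.
  have E1 g : sat (col_mx x u) (row_mx (- delta_mx 0 g) 0, 0) = (0 <= x g 0).
    by rewrite /sat /= lform_row_mx lform0 addr0 lformN lform_delta_row rmorph0
               oppr_le0.
  have E2 r : sat (col_mx x u) (row_mx (row r A) 0, endowment b S r 0) =
      ((map_mx ratr A *m x) r 0 <= ratr (endowment b S r 0)).
    by rewrite /sat /= lform_row_mx lform0 addr0 lform_row.
  have E3 i : sat (col_mx x u) (row_mx (- (v i)^T) (delta_mx 0 i), 0) =
      (u i 0 <= ((map_mx ratr (v i))^T *m x) 0 0).
    by rewrite /sat /= lform_row_mx lformN lform_delta_row rmorph0 valuationE
               addrC subr_le0.
  rewrite !all_cat; split=> [[[x_ge0 Ax] /= xu]|/and3P[/allP H1 /allP H2 /allP H3]].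
    apply/and3P; split; apply/allP => _ /mapP[i + ->].
    - by rewrite E1.
    - by rewrite E2.
    - by rewrite E3 mem_enum; exact: xu.
  split=> [|i iS] /=; last by rewrite -E3; apply/H3/map_f; rewrite mem_enum.
  split=> [g|r].
    by rewrite -E1; apply/H1/map_f; rewrite mem_enum.
  by rewrite -E2; apply/H2/map_f; rewrite mem_enum.
split=> [[[x u'] + /= u'E]|[x /LP xuS]]; last by exists (x, u).
by rewrite u'E => xuS; exists x; apply/LP.
Qed.

Lemma core_polyhedral_union : polyhedral_union (core R A b v).
Proof.
rewrite (_ : core R A b v = utilities R A b v finset.setT `&`
    [set u | forall S, S \in [seq S <- enum {: {set 'I_n.+1}} | S != finset.set0] ->
                       (~` interior (utilities R A b v S)) u]).
  apply: polyhedral_unionI.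
    have [L LP] := utilities_polyhedron finset.setT.
    by exists [:: L] => u; rewrite /= orbF.
  apply: polyhedral_union_bigcap => S _.
  have [L LP] := utilities_polyhedron S.
  exact: polyhedral_union_setC_interior LP.
apply/seteqP; split=> u [uN uC]; split=> //.
  move=> S; rewrite mem_filter => /andP[S0 _] uS; apply: uC.
  by exists S.
by case=> S /= S0; apply: uC; rewrite mem_filter S0 mem_enum.
Qed.

(** All coalitions share [A] and differ only in the right-hand side, so boundedness of one non-empty
    feasible set transfers to every other coalition. *)
Lemma feasible_bounded S S' : feasible R A b S !=set0 ->
  bounded_set (feasible R A b S) ->
  exists B : 'I_j.+1 -> R, forall x, feasible R A b S' x ->
    forall g, x g 0 <= B g.
Proof.
rewrite !feasibleE => S0 [M [_ SM]].
have coord_bnd g : exists B : R, forall x,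
    production A (map_mx ratr (endowment b S')) x -> x g 0 <= B.
  (* [bounded_set] makes every real above [M] a bound on the norm, hence the choice [M + 1]; an
     entry is at most the max norm. *)
  apply: (production_bounded_rhs (B := M + 1) _ S0) => x xS.
  have := SM (M + 1); rewrite ltrDl ltr01 => /(_ isT x xS) /=.
  apply: le_trans; apply: le_trans (ler_norm _) _.
  rewrite /Num.Def.normr /= mx_normrE.
  exact: (le_bigmax _ (fun i : 'I_j.+1 * 'I_1 => `|x i.1 i.2|) (g, 0)).
have [B BP] := choice coord_bnd.
by exists B => x xS g; exact: BP.
Qed.

(** If [u i 0] were smaller, it would stay so near [u]; as [U({i})] leaves the other coordinates
    free, [u] would be interior to it. *)
Lemma core_individually_rational i (x : 'cV[R]_j.+1) (u : 'cV[R]_n.+1) :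
  feasible R A b (finset.set1 i) x -> core R A b v u ->
  ((map_mx ratr (v i))^T *m x) 0 0 <= u i 0.
Proof.
move=> xi [_ uC]; rewrite leNgt; apply/negP => ux; apply: uC.
exists (finset.set1 i).
  by apply/eqP => /setP/(_ i); rewrite inE eqxx inE.
have /cvgr_lt/(_ _ ux) := @coord_continuous R _ _ i 0 u.
apply: filterS => w wx; exists (x, w) => //; split=> // i'.
by rewrite inE => /eqP ->; exact: ltW.
Qed.

(** From above, payoffs are limited by the goods available to the grand coalition, whose bound [B]
    is transferred from player [ord0]. From below, each player gets at least the value of a fixed
    bundle [x i] feasible alone. *)
Lemma core_bounded :
  (forall i, feasible R A b (finset.set1 i) !=set0 /\
     bounded_set (feasible R A b (finset.set1 i))) ->
  exists B : R, forall u i, core R A b v u -> `|u i 0| <= B.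
Proof.
move=> hX.
have [B BP] := feasible_bounded finset.setT (hX ord0).1 (hX ord0).2.
have [x xP] := choice (fun i => (hX i).1).
pose up i : R := \sum_g `|ratr ((v i) g 0)| * B g.
pose lo i : R := `|((map_mx ratr (v i))^T *m x i) 0 0|.
have up_ge i (u : 'cV[R]_n.+1) : core R A b v u -> u i 0 <= up i.
  case=> -[[y u'] [yN /= /(_ i) yu] /= <-] _.
  apply: le_trans (yu (finset.in_setT i)) _.
  rewrite mxE; apply: ler_sum => g _; rewrite !mxE.
  apply: le_trans (ler_wpM2r (yN.1 g) (ler_norm _)) _.
  by rewrite ler_wpM2l // BP.
(* Summing the non-negative individual bounds makes the bound independent of the player. *)
exists (\sum_i (`|up i| + lo i)) => u i uC.
apply: (@le_trans _ _ (`|up i| + lo i)).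
  have u_lo := core_individually_rational (xP i) uC.
  have := up_ge i u uC; have := ler_norm (up i); have := normr_ge0 (up i).
  rewrite ler_norml; move: u_lo.
  have := ler_norm (- ((map_mx ratr (v i))^T *m x i) 0 0).
  rewrite normrN -/(lo i) => *; have : 0 <= lo i by exact: normr_ge0.
  by move=> ?; apply/andP; split; lra.
rewrite (bigD1 i) //= lerDl sumr_ge0 // => i' _.
by rewrite addr_ge0 ?normr_ge0.
Qed.

End Game.

Unset Implicit Arguments.

Theorem theorem3p8 (R : realType) (n k j : nat)
    (A : 'M[rat]_(k.+1, j.+1))
    (b : 'I_n.+1 -> 'cV[rat]_k.+1)
    (v : 'I_n.+1 -> 'cV[rat]_j.+1)
    (hX : forall i : 'I_n.+1,
       feasible R A b (finset.set1 i) !=set0 /\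
       bounded_set (feasible R A b (finset.set1 i)))
    (hC : core R A b v !=set0) :
  MIP_representable (core R A b v).
Proof.
apply: MIP_representable_polyhedral_union.
  exact: core_polyhedral_union.
exact: core_bounded.
Qed.
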